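(* Let $(\mathfrak g,\{\mathfrak M_{p,q}\}_{p\ge0,q\ge1})$ be a post-Lie$_\infty$ algebra. For $k\ge 1$ define $$l^C_k(x_1,\ldots,x_k)= \sum_{j=0}^{k-1}\sum_{\sigma\in\mathbb S_{(j,k-j)}}\varepsilon(\sigma)\,\mathfrak M_{j,k-j}(x_{\sigma(1)} \cdots x_{\sigma(j)}\otimes x_{\sigma(j+1)} \cdots x_{\sigma(k)}),\qquad x_1,\ldots,x_k\in \mathfrak g.$$ Then $(\mathfrak g,\{l^C_k\}_{k=1}^{+\infty})$ is an $L_\infty$-algebra (called the sub-adjacent $L_\infty$-algebra). Moreover, $(\mathfrak g,\mathfrak g,\{l^C_k\}_{k=1}^{+\infty},\{\mathfrak M_{p,q}\}_{p+q\ge1})$ is an open-closed homotopy Lie algebra such that $\mathfrak M_{p,0}=0$ for all $p\ge1$.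
   Context: The ground field has characteristic zero; graded means $\mathbb Z$-graded; in exponents of $-1$ a homogeneous element stands for its degree. $\mathsf S(V)$ is the graded symmetric algebra, products in it are written by juxtaposition; $\mathbb S_{(i_1,\dots,i_k)}$ is the set of $(i_1,\dots,i_k)$-shuffles; $\varepsilon(\sigma)$ is the Koszul sign: $v_1\cdots v_n=\varepsilon(\sigma)v_{\sigma(1)}\cdots v_{\sigma(n)}$ in $\mathsf S(V)$. An $L_\infty$-algebra $(\mathfrak g,\{l_k\}_{k\ge1})$ is a graded vector space with graded symmetric maps $l_k:\mathsf S^k(\mathfrak g)\to\mathfrak g$ of degree $1$ such that for all $n\ge1$: $\sum_{i=1}^{n}\sum_{\sigma\in \mathbb S_{(i,n-i)}}\varepsilon(\sigma)l_{n-i+1}(l_i(x_{\sigma(1)},\ldots,x_{\sigma(i)}),x_{\sigma(i+1)},\ldots,x_{\sigma(n)})=0$. A post-Lie$_\infty$ algebra is a graded vector space $\mathfrak g$ with linear maps $\mathfrak M_{p,q}:\mathsf S^p(\mathfrak g)\otimes \mathsf S^q(\mathfrak g)\to\mathfrak g$ of degree $1$, $p\ge0,q\ge1$, such that for all $n\ge 0,m\ge1$ and homogeneous $x_1,\dots,x_{n+m}$ $$\begin{aligned}&\sum_{\substack{0\le j\le n-1,\,1\le i\le n\\ i+j\le n}}\ \sum_{\sigma\in \mathbb S_{(j,i,n-j-i)}}\varepsilon(\sigma)\mathfrak M_{n-j-i+1,m}\Big(\mathfrak M_{j,i}(x_{\sigma(1)}\cdots x_{\sigma(j)}\otimes x_{\sigma(j+1)}\cdots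 x_{\sigma(j+i)})x_{\sigma(j+i+1)}\cdots x_{\sigma(n)}\otimes x_{n+1}\cdots x_{n+m}\Big)\\ &+\sum_{0\le j\le n}\sum_{\sigma\in\mathbb S_{(n-j,j)}}\sum_{1\le i\le m}\sum_{\tau\in\mathbb S_{(i,m-i)}}\varepsilon(\sigma)\varepsilon(\tau)(-1)^{x_{\sigma(1)}+\cdots+x_{\sigma(n-j)}}\\ &\mathfrak M_{n-j,m-i+1}\Big(x_{\sigma(1)} \cdots x_{\sigma(n-j)}\otimes \mathfrak M_{j,i}\big(x_{\sigma(n-j+1)} \cdots x_{\sigma(n)}\otimes x_{n+\tau(1)} \cdots x_{n+\tau(i)}\big) x_{n+\tau(i+1)} \cdots x_{n+\tau(m)}\Big)=0.\end{aligned}$$ An open-closed homotopy Lie algebra $(\mathfrak g,\mathfrak h,\{l_k\}_{k\ge1},\{\mathfrak R_{p,q}\}_{p+q\ge1})$ is an $L_\infty$-algebra $(\mathfrak g,\{l_k\})$, a graded vector space $\mathfrak h$ and degree $1$ linear maps $\mathfrak R_{p,q}:\mathsf S^p(\mathfrak g)\otimes \mathsf S^q(\mathfrak h)\to\mathfrak h$ ($p,q\ge0$, $p+q\ge1$; put $\mathfrak R_{0,0}=0$) such that for all $n+m\ge1$, $x_i\in\mathfrak g$, $u_j\in\mathfrak h$ $$\begin{aligned}&\sum_{i=1}^{n}\sum_{\sigma\in \mathbb S_{(i,n-i)}}\varepsilon(\sigma)\mathfrak R_{n-i+1,m}\Big(l_i(x_{\sigma(1)},\ldots,x_{\sigma(i)})x_{\sigma(i+1)}\cdots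 x_{\sigma(n)}\otimes u_1 \cdots u_m\Big)\\ &+\sum_{i=0}^{n}\sum_{k=0}^{m}\sum_{\sigma\in\mathbb S_{(i,n-i)}}\sum_{\tau\in\mathbb S_{(k,m-k)}}\varepsilon(\sigma)\varepsilon(\tau)(-1)^{x_{\sigma(1)}+\cdots+x_{\sigma(i)}}\\ &\mathfrak R_{i,m-k+1}\Big(x_{\sigma(1)} \cdots x_{\sigma(i)}\otimes \mathfrak R_{n-i,k}\big(x_{\sigma(i+1)} \cdots x_{\sigma(n)}\otimes u_{\tau(1)} \cdots u_{\tau(k)}\big) u_{\tau(k+1)} \cdots u_{\tau(m)}\Big)=0.\end{aligned}$$ In the claim the family $\{\mathfrak M_{p,q}\}_{p+q\ge 1}$ is obtained from $\{\mathfrak M_{p,q}\}_{p\ge 0,q\ge 1}$ by setting $\mathfrak M_{p,0}=0$ for $p\ge1$. *)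

(* Defs.v *)
From HB Require Import structures.
From mathcomp Require Import all_boot all_order all_fingroup all_algebra.

Set Implicit Arguments.
Unset Strict Implicit.
Unset Printing Implicit Defensive.

Import Order.TTheory GRing.Theory Num.Theory.
Local Open Scope ring_scope.

Definition gradedSpace (K : fieldType) := int -> lmodType K.

(* Homogeneous elements, each carrying its degree (so 0 occurs once in every
   degree); they determine all (multi)linear maps on a graded space. *)
Definition homog (K : fieldType) (V : gradedSpace K) := {d : int & V d}.

Definition elt (K : fieldType) (V : gradedSpace K) (d : int) (v : V d) :
  homog V := Tagged V v.

(* The component in degree e: the element itself if its degree is e, 0 if not.
   Identities between homogeneous elements whose degrees agree only up to a
   propositional equality of integers are stated componentwise. *)
Definition component (K : fieldType) (V : gradedSpace K) (e : int)
  (h : homog V) : V e :=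
  untag (T_ := fun d => V d : Type) 0 id h.

Definition degs (K : fieldType) (V : gradedSpace K) (s : seq (homog V)) : int :=
  \sum_(h <- s) tag h.

(* Families of degree 1 maps on words of homogeneous elements; the arities are
   the lengths of the words: l_k(x_1, ..., x_k) is l [:: x_1; ...; x_k], and
   R_{p,q}(x_1 ... x_p (x) u_1 ... u_q) is
   R [:: x_1; ...; x_p] [:: u_1; ...; u_q]. *)
Definition ops (K : fieldType) (V : gradedSpace K) :=
  forall s : seq (homog V), V (degs s + 1).

Definition ops2 (K : fieldType) (V W : gradedSpace K) :=
  forall (s : seq (homog V)) (t : seq (homog W)), W (degs s + degs t + 1).

Definition app (K : fieldType) (V : gradedSpace K) (l : ops V)
  (s : seq (homog V)) : homog V := elt (l s).

Definition app2 (K : fieldType) (V W : gradedSpace K) (R : ops2 V W)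
  (s : seq (homog V)) (t : seq (homog W)) : homog W := elt (R s t).

Definition multilinear (K : fieldType) (V W : gradedSpace K)
  (f : seq (homog V) -> homog W) : Prop :=
  forall (s t : seq (homog V)) (d : int) (a : K) (u v : V d) (e : int),
    component e (f (s ++ elt (a *: u + v) :: t)) =
    a *: component e (f (s ++ elt u :: t)) + component e (f (s ++ elt v :: t)).

(* f kills the relations v w = (-1)^(v w) w v that define S(V) as a quotient
   of the tensor algebra. *)
Definition graded_symmetric (K : fieldType) (V W : gradedSpace K)
  (f : seq (homog V) -> homog W) : Prop :=
  forall (s t : seq (homog V)) (v w : homog V) (e : int),
    component e (f (s ++ v :: w :: t)) =
    (-1) ^ (tag v * tag w) *: component e (f (s ++ w :: v :: t)).

(* f induces a linear map on each symmetric power S^k(V), k >= 1. *)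
Definition linear_on_S (K : fieldType) (V W : gradedSpace K)
  (f : seq (homog V) -> homog W) : Prop :=
  multilinear f /\ graded_symmetric f.

(* With permuted x s = x_{s(1)} ... x_{s(n)}, s is a shuffle for b when its
   values increase on each of the consecutive blocks of lengths b. *)
Definition shuffle (n : nat) (b : seq nat) (s : 'S_n) : bool :=
  all (sorted ltn) (reshape b [seq val (s i) | i <- enum 'I_n]).

Definition permuted (n : nat) (T : Type) (x : n.-tuple T) (s : 'S_n) : seq T :=
  [seq tnth x (s i) | i <- enum 'I_n].

(* The sign with x_1 ... x_n = koszul x s * x_{s(1)} ... x_{s(n)} in S(V): each
   pair of letters that s puts in the opposite order contributes
   (-1)^(product of their degrees). *)
Definition koszul (K : fieldType) (V : gradedSpace K) (n : nat)
  (x : n.-tuple (homog V)) (s : 'S_n) : K :=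
  \prod_(i < n) \prod_(j < n | (i < j)%N && (s j < s i)%N)
    (-1) ^ (tag (tnth x (s i)) * tag (tnth x (s j))).

(* The value of l at the empty word is irrelevant. *)
Definition is_Linfty (K : fieldType) (V : gradedSpace K) (l : ops V) : Prop :=
  linear_on_S (app l) /\
  forall (n : nat) (x : n.-tuple (homog V)) (e : int), (1 <= n)%N ->
    \sum_(1 <= i < n.+1) \sum_(s : 'S_n | shuffle [:: i; n - i]%N s)
      koszul x s *: component e
        (app l (app l (take i (permuted x s)) :: drop i (permuted x s))) = 0.

(* Only the M_{p,q} with q >= 1, i.e. the values of M at nonempty second words,
   are constrained. *)
Definition is_postLie_infty (K : fieldType) (V : gradedSpace K)
  (M : ops2 V V) : Prop :=
  [/\ forall t, (1 <= size t)%N -> linear_on_S (fun s => app2 M s t),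
      forall s, linear_on_S (app2 M s) &
      forall (n m : nat) (x : n.-tuple (homog V)) (y : m.-tuple (homog V))
             (e : int), (1 <= m)%N ->
        \sum_(0 <= j < n) \sum_(1 <= i < n.+1 | (i + j <= n)%N)
          \sum_(s : 'S_n | shuffle [:: j; i; n - j - i]%N s)
            koszul x s *: component e
              (app2 M (app2 M (take j (permuted x s))
                              (take i (drop j (permuted x s)))
                       :: drop (j + i)%N (permuted x s)) y)
        + \sum_(0 <= j < n.+1) \sum_(s : 'S_n | shuffle [:: n - j; j]%N s)
          \sum_(1 <= i < m.+1) \sum_(t : 'S_m | shuffle [:: i; m - i]%N t)
            (koszul x s * koszul y t
             * (-1) ^ degs (take (n - j)%N (permuted x s))) *: component e
              (app2 M (take (n - j)%N (permuted x s))
                      (app2 M (drop (n - j)%N (permuted x s))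
                              (take i (permuted y t))
                       :: drop i (permuted y t)))
        = 0].

Definition is_open_closed (K : fieldType) (V W : gradedSpace K)
  (l : ops V) (R : ops2 V W) : Prop :=
  [/\ is_Linfty l,
      (forall t, linear_on_S (fun s => app2 R s t)) /\
      (forall s, linear_on_S (app2 R s)),
      R [::] [::] = 0 &
      forall (n m : nat) (x : n.-tuple (homog V)) (u : m.-tuple (homog W))
             (e : int), (1 <= n + m)%N ->
        \sum_(1 <= i < n.+1) \sum_(s : 'S_n | shuffle [:: i; n - i]%N s)
          koszul x s *: component e
            (app2 R (app l (take i (permuted x s)) :: drop i (permuted x s)) u)
        + \sum_(0 <= i < n.+1) \sum_(0 <= k < m.+1)
          \sum_(s : 'S_n | shuffle [:: i; n - i]%N s)
          \sum_(t : 'S_m | shuffle [:: k; m - k]%N t)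
            (koszul x s * koszul u t
             * (-1) ^ degs (take i (permuted x s))) *: component e
              (app2 R (take i (permuted x s))
                      (app2 R (drop i (permuted x s)) (take k (permuted u t))
                       :: drop k (permuted u t)))
        = 0].

Definition sub_adjacent (K : fieldType) (V : gradedSpace K) (M : ops2 V V) :
  ops V := fun w =>
  \sum_(0 <= j < size w)
    \sum_(s : 'S_(size w) | shuffle [:: j; size w - j]%N s)
      koszul (in_tuple w) s *: component (degs w + 1)
        (app2 M (take j (permuted (in_tuple w) s))
                (drop j (permuted (in_tuple w) s))).

(* The family with the M_{p,0} replaced by 0. *)
Definition extend0 (K : fieldType) (V : gradedSpace K) (M : ops2 V V) :
  ops2 V V := fun s t => if nilp t then 0 else M s t.

(* Main.v *)
Require Import Defs.
From HB Require Import structures.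
From mathcomp Require Import all_boot all_order all_fingroup all_algebra.
From mathcomp Require Import zify.

Set Implicit Arguments.
Unset Strict Implicit.
Unset Printing Implicit Defensive.

Import Order.TTheory GRing.Theory Num.Theory.
Local Open Scope ring_scope.

(* A signed sum over shuffles is a sum over an iterated coproduct of S(V); such
   sums obey coassociativity and graded cocommutativity, proved by induction on
   words, so no shuffle has to be composed with another one.  With M_{p,0} = 0,
   write m(a,b) for M(a (x) b).  The post-Lie identity E(z, y) = 0 becomes
     sum over z -> (a,b,p) of m(m(a,b) p, y)
     + sum over z -> (p,a), y -> (b,q) of (-1)^p m(p, m(a,b) q) = 0,
   and l^C(w) is the sum of m(p,q) over w -> (p,q), so that E(z, y) is also the
   open-closed identity.  In l^C(l^C(s) t) the letter l^C(s) goes either to the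
   first or to the second argument of the outer m, which makes the Jacobi sum of
   w equal to the sum of E(z, y) over w -> (z, y). *)

(** * Inserting one letter into words, permutations and shuffles *)

Definition insert (T : Type) (p : nat) (x : T) (w : seq T) : seq T :=
  take p w ++ x :: drop p w.

Lemma map_enum_insert (n : nat) (T : Type) (f : 'I_n.+1 -> T) (p : 'I_n.+1) :
  [seq f i | i <- enum 'I_n.+1] =
  insert p (f p) [seq f (lift p i) | i <- enum 'I_n].
Proof.
have szn : size [seq f (lift p i) | i <- enum 'I_n] = n.
  by rewrite size_map size_enum_ord.
have lepn : (p <= n)%N by rewrite -ltnS.
apply: (@eq_from_nth _ (f p)) => [|i].
  rewrite size_cat /= size_takel ?szn // size_drop szn.
  by rewrite size_map size_enum_ord addnS subnKC.
rewrite size_map size_enum_ord => ltin.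
rewrite (nth_map p) ?size_enum_ord // (nth_ord_enum p (Ordinal ltin)).
rewrite nth_cat size_takel ?szn //.
case: (unliftP p (Ordinal ltin)) => [j|] /(congr1 val) /=; rewrite /bump => Ei.
  have -> : Ordinal ltin = lift p j by apply/val_inj.
  case: (leqP p j) Ei => [le_pj|lt_jp] /= Ei.
    rewrite Ei ifF; last by rewrite add1n ltnNge leqW.
    rewrite add1n subSn //= nth_drop subnKC //.
    by rewrite (nth_map j) ?size_enum_ord // nth_ord_enum.
  rewrite Ei add0n lt_jp nth_take // (nth_map j) ?size_enum_ord //.
  by rewrite nth_ord_enum.
have -> : Ordinal ltin = p by apply: val_inj.
by rewrite Ei ltnn subnn.
Qed.

(** Permutations are classified by the position [p] of the value [0]; deleting that position and
    that value leaves an arbitrary permutation of [n] letters. *)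
Lemma sum_lift_perm (n : nat) (U : nmodType) (F : 'S_n.+1 -> U) :
  \sum_s F s = \sum_p \sum_(s : 'S_n) F (lift_perm p ord0 s).
Proof.
rewrite (partition_big (fun s : 'S_n.+1 => (s^-1)%g ord0) predT) //=.
apply: eq_bigr => p _; rewrite (reindex (lift_perm p ord0)).
  apply: eq_bigl => s; rewrite -{2}(lift_perm_id p ord0 s) permK.
  exact: eqxx.
(* [ulsf i s] is [s] with the index [i] and its value [s i] removed; the default [k] is never
   reached, since [lift i k] differs from [i]. *)
pose ulsf i (s : 'S_n.+1) k := odflt k (unlift (s i) (s (lift i k))).
have ulsfK i (s : 'S_n.+1) k: lift (s i) (ulsf i s k) = s (lift i k).
  rewrite /ulsf; have:= neq_lift i k.
  by rewrite -(can_eq (permK s)) => /unlift_some[] ? ? ->.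
have inj_ulsf: injective (ulsf p _).
  move=> s; apply: can_inj (ulsf (s p) s^-1%g) _ => k'.
  by rewrite {1}/ulsf ulsfK !permK liftK.
exists (fun s => perm (inj_ulsf s)) => [s _ | s].
  by apply/permP=> k'; rewrite permE /ulsf lift_perm_lift lift_perm_id liftK.
rewrite inE => /eqP Es; have si0 : s p = ord0 by rewrite -Es permKV.
apply/permP=> k; case: (unliftP p k) => [k'|] ->; rewrite ?lift_perm_id //.
by rewrite lift_perm_lift -si0 permE ulsfK.
Qed.

Lemma sorted_insert_min (L : seq nat) (p : nat) :
  all (ltn 0) L -> sorted ltn L -> (p <= size L)%N ->
  sorted ltn (insert p 0%N L) = (p == 0)%N.
Proof.
case: p => [|p] L_gt0 sL ltpL.
  rewrite /insert take0 drop0 /=.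
  by case: L L_gt0 sL ltpL => //= y L /andP[-> _] ->.
case: L L_gt0 sL ltpL => [|y L] //= /andP[y0 _] _ _.
by rewrite /insert /= cat_path /= andbF.
Qed.

Lemma take_insert (T : Type) (p a : nat) (x : T) (L : seq T) :
  (p <= size L)%N ->
  take a (insert p x L) =
  if (p < a)%N then insert p x (take a.-1 L) else take a L.
Proof.
move=> lepL; rewrite /insert take_cat size_takel //.
case: ltngtP => [ltap|ltpa|->]; first by rewrite take_takel // ltnW.
  case: a ltpa => // a; rewrite ltnS => lepa.
  by rewrite subSn //= take_takel // take_drop subnK.
by rewrite subnn /= cats0.
Qed.

Lemma drop_insert (T : Type) (p a : nat) (x : T) (L : seq T) :
  (p <= size L)%N ->
  drop a (insert p x L) =
  if (p < a)%N then drop a.-1 L else insert (p - a) x (drop a L).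
Proof.
move=> lepL; rewrite /insert drop_cat size_takel //.
case: ltngtP => [ltap|ltpa|->].
- by rewrite take_drop drop_drop subnK ?(ltnW ltap).
- case: a ltpa => // a; rewrite ltnS => lepa.
  by rewrite subSn //= drop_drop subnK.
by rewrite subnn /= take0 drop0.
Qed.

(** The inserted [0] falls into the first block exactly when [p < a], and as the minimum it must
    then stand at its head; otherwise the question passes to the remaining blocks. *)
Lemma reshape_insert_min (L : seq nat) (p a : nat) (b : seq nat) :
  all (ltn 0) L -> (p <= size L)%N ->
  all (sorted ltn) (reshape (a :: b) (insert p 0%N L)) =
  if (p < a)%N then
    (p == 0)%N && all (sorted ltn) (reshape (a.-1 :: b) L)
  else sorted ltn (take a L) &&
    all (sorted ltn) (reshape b (insert (p - a) 0%N (drop a L))).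
Proof.
move=> L0 lepL /=; rewrite take_insert // drop_insert //.
case: ltnP => // ltpa; rewrite andbA; congr (_ && _).
have La0 : all (ltn 0) (take a.-1 L).
  by move: L0; rewrite -{1}(cat_take_drop a.-1 L) all_cat => /andP[].
have lepLa : (p <= size (take a.-1 L))%N.
  by rewrite size_take; case: ifP => _; lia.
case sL: (sorted ltn (take a.-1 L)); first by rewrite andbT sorted_insert_min.
(* Inserting an entry cannot repair an unsorted block, because the old block remains a subsequence
   of the new one. *)
rewrite andbF; apply/negP => sI; move/negP: sL; apply.
apply: (subseq_sorted ltn_trans _ sI).
rewrite -{1}(cat_take_drop p (take a.-1 L)) /insert.
by apply: cat_subseq => //; apply: subseq_cons.
Qed.

(** The minimum has to head one of the three blocks. The conditions [0 < a], [0 < b], [0 < c] keep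
    the cases disjoint when empty blocks make starting positions coincide. *)
Lemma reshape3_insert_min (L : seq nat) (p a b c : nat) :
  all (ltn 0) L -> (p <= size L)%N -> (a + b + c = (size L).+1)%N ->
  let sh a b c := all (sorted ltn) (reshape [:: a; b; c] L) in
  all (sorted ltn) (reshape [:: a; b; c] (insert p 0%N L)) =
  [|| [&& p == 0, 0 < a & sh a.-1 b c],
      [&& p == a, 0 < b & sh a b.-1 c] |
      [&& p == a + b, 0 < c & sh a b c.-1]]%N.
Proof.
move=> L0 lepL szL sh.
have L0d k : all (ltn 0) (drop k L).
  by move: L0; rewrite -{1}(cat_take_drop k L) all_cat => /andP[].
rewrite reshape_insert_min //; case: ltnP => [ltpa|leap].
  rewrite [(p == a)%N]ltn_eqF // [(p == a + b)%N]ltn_eqF ?orbF; last by lia.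
  by rewrite (leq_ltn_trans (leq0n p) ltpa).
rewrite reshape_insert_min // ?size_drop; last by lia.
have -> : [&& p == 0, 0 < a & sh a.-1 b c]%N = false.
  by apply/negP => /and3P[/eqP p0 a0 _]; move: leap; rewrite p0 leqNgt a0.
rewrite orFb subn_eq0; case: ltnP => [ltpb|lebp].
  rewrite [(p == a + b)%N]ltn_eqF ?orbF; last by lia.
  have -> : (0 < b)%N by lia.
  rewrite /sh /= [in RHS]andbCA; congr (_ && _).
  by rewrite [(p == a)%N]eqn_leq leap !andbT.
rewrite reshape_insert_min ?size_drop //; [|by rewrite drop_drop|lia].
have -> : [&& p == a, 0 < b & sh a b.-1 c]%N = false.
  by apply/negP => /and3P[/eqP pa b0 _]; lia.
have -> : (p - a - b < c)%N by lia.
have -> : (0 < c)%N by lia.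
rewrite /sh /=; have -> : (p - a - b == 0)%N = (p == a + b)%N by lia.
by do !case: (sorted _ _); rewrite ?andbT ?andbF.
Qed.

(** * Koszul signs of permuted words *)

Section Unshuffle.
Variables (K : fieldType) (V : gradedSpace K).
Local Notation T := (homog V).
Implicit Types w s t : seq T.

Definition ksign (a : int) : K := (-1) ^ a.

Lemma ksignD (a b : int) : ksign (a + b) = ksign a * ksign b.
Proof. by rewrite /ksign expfzDr // oppr_eq0 oner_eq0. Qed.

Lemma ksign_sq (a : int) : ksign a * ksign a = 1.
Proof. by rewrite /ksign -expfzMl mulrNN mulr1 exp1rz. Qed.

Lemma degs_nil : degs (V := V) [::] = 0.
Proof. by rewrite /degs big_nil. Qed.

Lemma degs_cons x s : degs (x :: s) = tag x + degs s.
Proof. by rewrite /degs big_cons. Qed.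

Lemma degs_cat s t : degs (s ++ t) = degs s + degs t.
Proof. by rewrite /degs big_cat. Qed.

(* A permutation s of n + 1 letters is determined by the position p of the first
   letter and a permutation of the other ones: s = lift_perm p ord0 s'. *)
Lemma permuted_lift (n : nat) (x : T) (w : n.-tuple T) (s : 'S_n) p :
  permuted [tuple of x :: w] (lift_perm p ord0 s) = insert p x (permuted w s).
Proof.
rewrite /permuted (map_enum_insert _ p) lift_perm_id tnth0; congr insert.
by apply: eq_map => i; rewrite lift_perm_lift tnthS.
Qed.

Lemma size_permuted (n : nat) (w : n.-tuple T) (s : 'S_n) :
  size (permuted w s) = n.
Proof. by rewrite size_map size_enum_ord. Qed.

Lemma degs_take_permuted (n : nat) (w : n.-tuple T) (s : 'S_n) p :
  degs (take p (permuted w s)) =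
  \sum_(i < n | (i < p)%N) tag (tnth w (s i)).
Proof.
have [lepn|ltnp] := leqP p n; last first.
  rewrite take_oversize ?size_permuted ?(ltnW ltnp) //.
  rewrite /degs big_map big_enum; apply: eq_bigl => i.
  by rewrite (ltn_trans (ltn_ord i) ltnp).
case: n w s lepn => [|n] w s lepn.
  rewrite [permuted _ _]size0nil ?size_permuted // degs_nil.
  by rewrite big_ord0.
rewrite /permuted -map_take /degs big_map (big_nth ord0) size_take.
rewrite size_enum_ord; have -> : (if p < n.+1 then p else n.+1)%N = p.
  by case: ltnP => // lenp; apply/eqP; rewrite eqn_leq lenp.
rewrite big_mkord (big_ord_widen_cond _ predT (fun i => tag
  (tnth w (s (nth ord0 (take p (enum 'I_n.+1)) i)))) lepn) /=.
by apply: eq_bigr => i lt_ip; rewrite nth_take // nth_ord_enum.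
Qed.

(** The value at position [p] is the smallest one, so the new inversions are exactly those of [x]
    with the [p] letters in front of it. *)
Lemma koszul_lift (n : nat) (x : T) (w : n.-tuple T) (s : 'S_n) p :
  koszul [tuple of x :: w] (lift_perm p ord0 s) =
  ksign (tag x * degs (take p (permuted w s))) * koszul w s.
Proof.
(* Pairs with [p] on the left contribute nothing, since no value lies below [0]. *)
rewrite /koszul (bigD1_ord p) //= big1 ?mul1r => [|j]; last first.
  by rewrite lift_perm_id ltn0 andbF.
rewrite degs_take_permuted mulr_sumr /ksign.
have -> : (-1) ^ (\sum_(i < n | (i < p)%N) tag x * tag (tnth w (s i))) =
   \prod_(i < n | (i < p)%N) (-1 : K) ^ (tag x * tag (tnth w (s i))).
  by elim/big_rec2: _ => // i y1 y2 _ <-; rewrite expfzDr // oppr_eq0 oner_eq0.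
rewrite [in RHS]big_mkcond -big_split /=; apply: eq_bigr => i _.
rewrite big_mkcond (bigD1_ord p) //= lift_perm_id lift_perm_lift tnth0 tnthS.
congr (_ * _).
  rewrite /= /bump leq0n andbT mulrC; case: (leqP p i) => lepi.
    by rewrite add1n ltnNge leqW.
  by rewrite add0n lepi.
rewrite [in RHS]big_mkcond; apply: eq_bigr => j _.
rewrite lift_perm_lift tnthS /= !/(bump 0 _) !leq0n !add1n ltnS.
congr (if _ && _ then _ else _).
rewrite /bump; lia.
Qed.

(** * The shuffle coproduct of a word *)

Section Functional.
Variable U : lmodType K.
Implicit Types F G : seq T -> seq T -> U.

(* unsh w F is the sum of F over the shuffle coproduct of w in S(V) (x) S(V):
   each letter x goes left or right, passing in the second case the letters s
   already sent left. *)
Fixpoint unsh w F : U :=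
  if w is x :: w' then
    unsh w' (fun s t => F (x :: s) t)
    + unsh w' (fun s t => ksign (tag x * degs s) *: F s (x :: t))
  else F [::] [::].

(** Every splitting of [w] preserves total length and total degree; having both as hypotheses is
    what later comparisons of signs and block lengths rely on. *)
Lemma eq_unsh w F G :
  (forall s t, (size s + size t = size w)%N -> degs s + degs t = degs w ->
     F s t = G s t) ->
  unsh w F = unsh w G.
Proof.
elim: w F G => [|x w IHw] F G eqFG /=.
  by apply: eqFG; rewrite ?degs_nil ?addr0.
congr (_ + _); apply: IHw => s t sz dg.
  by apply: eqFG; rewrite /= ?addSn ?sz // !degs_cons -addrA dg.
congr (_ *: _); apply: eqFG; rewrite /= ?addnS ?sz //.
by rewrite !degs_cons addrCA dg.
Qed.

Lemma unshD w F G :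
  unsh w (fun s t => F s t + G s t) = unsh w F + unsh w G.
Proof.
elim: w F G => //= x w IHw F G; rewrite [RHS]addrACA.
rewrite -[X in _ = X + _]IHw -[X in _ = _ + X]IHw; congr (_ + _).
by apply: eq_unsh => s t _ _; rewrite scalerDr.
Qed.

Lemma unshZ w c F : unsh w (fun s t => c *: F s t) = c *: unsh w F.
Proof.
elim: w F => //= x w IHw F; rewrite scalerDr -!IHw; congr (_ + _).
by apply: eq_unsh => s t _ _; rewrite !scalerA mulrC.
Qed.

Lemma unsh0 w : unsh w (fun _ _ => 0) = 0.
Proof.
elim: w => //= x w IHw; rewrite IHw add0r -[RHS]IHw.
by apply: eq_unsh => s t _ _; rewrite scaler0.
Qed.

Lemma unsh_sum w I (r : seq I) (P : pred I) (F : I -> seq T -> seq T -> U) :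
  unsh w (fun s t => \sum_(i <- r | P i) F i s t) =
  \sum_(i <- r | P i) unsh w (F i).
Proof.
elim: r => [|i r IHr].
  rewrite big_nil -[RHS](unsh0 w); apply: eq_unsh => s t _ _.
  by rewrite big_nil.
rewrite big_cons -IHr; case Pi: (P i); last first.
  by apply: eq_unsh => s t _ _; rewrite big_cons Pi.
by rewrite -unshD; apply: eq_unsh => s t _ _; rewrite big_cons Pi.
Qed.

End Functional.

Lemma unsh_linear (U W : lmodType K) (f : U -> W) w F :
  linear f -> f (unsh w F) = unsh w (fun s t => f (F s t)).
Proof.
move=> lf; have f0 : f 0 = 0.
  by have := lf (-1) 0 0; rewrite scaler0 addr0 scaleN1r addNr.
have fZ c u : f (c *: u) = c *: f u by have := lf c u 0; rewrite f0 !addr0.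
have fD u v : f (u + v) = f u + f v by have := lf 1 u v; rewrite !scale1r.
elim: w F => //= x w IHw F; rewrite fD !IHw; congr (_ + _).
by apply: eq_unsh => s t _ _; rewrite fZ.
Qed.

(** By induction, the first letter goes to one of three places. To reach the last one it passes [s]
    and [p], and [degs s + degs p = degs z] makes the two signs agree. *)
Lemma unsh_coassoc (U : lmodType K) w (F : seq T -> seq T -> seq T -> U) :
  unsh w (fun s t => unsh t (fun p q => F s p q)) =
  unsh w (fun z q => unsh z (fun s p => F s p q)).
Proof.
elim: w F => //= x w IHw F; rewrite unshD -!IHw -addrA; congr (_ + _).
under eq_unsh => s t _ _ do rewrite scalerDr -!unshZ.
rewrite unshD; congr (_ + _).
transitivity (unsh w (fun s t => unsh t (fun p q =>
  ksign (tag x * (degs s + degs p)) *: F s p (x :: q)))).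
  apply: eq_unsh => s t _ _; apply: eq_unsh => p q _ _.
  by rewrite scalerA mulrDr ksignD.
rewrite IHw; apply: eq_unsh => z q _ _; rewrite -unshZ.
by apply: eq_unsh => s p _ ->.
Qed.

(** The exchange moves the first letter past the other half. In one branch this yields the sign that
    [unsh] expects; in the other the factor occurs twice and cancels. *)
Lemma unsh_cocomm (U : lmodType K) w (F : seq T -> seq T -> U) :
  unsh w F = unsh w (fun s t => ksign (degs s * degs t) *: F t s).
Proof.
elim: w F => //= [|x w IHw] F; first by rewrite degs_nil mulr0 scale1r.
rewrite addrC IHw [X in _ + X = _]IHw; congr (_ + _).
  apply: eq_unsh => s t _ _; rewrite !scalerA; congr (_ *: _).
  by rewrite degs_cons mulrDl ksignD mulrC.
apply: eq_unsh => s t _ _; rewrite scalerA degs_cons mulrDr ksignD.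
by rewrite [degs s * tag x]mulrC mulrA ksign_sq mul1r.
Qed.

(** * Signed sums over shuffles as coproduct sums *)

Definition shuffle_split (U : lmodType K) (a b c : nat) (F : seq T -> U) p q r :=
  if [&& size p == a, size q == b & size r == c] then F (p ++ q ++ r) else 0.

Lemma shuffle_lift (n : nat) (a b c : nat) (s : 'S_n) (p : 'I_n.+1) :
  (a + b + c = n.+1)%N ->
  shuffle [:: a; b; c] (lift_perm p ord0 s) =
  [|| (p == 0 :> nat) && (0 < a) && shuffle [:: a.-1; b; c] s,
      (p == a :> nat) && (0 < b) && shuffle [:: a; b.-1; c] s |
      (p == a + b :> nat) && (0 < c) && shuffle [:: a; b; c.-1] s]%N.
Proof.
move=> szn; rewrite -!andbA /shuffle (map_enum_insert _ p) lift_perm_id.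
set L := [seq val (s i) | i <- enum 'I_n].
have -> : [seq val (lift_perm p ord0 s (lift p i)) | i <- enum 'I_n] =
    map S L.
  by rewrite /L -map_comp; apply: eq_map => i /=; rewrite lift_perm_lift.
have sL : size L = n by rewrite size_map size_enum_ord.
have shS (b' : seq nat) : all (sorted ltn) (reshape b' (map S L)) =
    all (sorted ltn) (reshape b' L).
  elim: b' L {sL} => //= k b' IH L; rewrite -map_take -map_drop IH.
  by rewrite sorted_map; congr (_ && _).
have szS : size (map S L) = n by rewrite size_map.
rewrite reshape3_insert_min ?shS ?szS // ?leq_ord //.
by rewrite all_map; apply/allP.
Qed.

(** Induction on [n]: the first letter heads one of the three blocks, and these are the three places
    where the iterated [unsh] can send it, with the same sign. [shuffle_split] discards all other
    block lengths. *)
Lemma sum_shuffle (U : lmodType K) (n : nat) (w : n.-tuple T) (a b c : nat)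
    (F : seq T -> U) : (a + b + c = n)%N ->
  \sum_(s : 'S_n | shuffle [:: a; b; c] s) koszul w s *: F (permuted w s) =
  unsh w (fun z r => unsh z (fun p q => shuffle_split a b c F p q r)).
Proof.
elim: n w a b c F => [|n IHn] w a b c F szn.
  have [-> [-> ->]] : a = 0%N /\ b = 0%N /\ c = 0%N by lia.
  rewrite tuple0 /= /shuffle_split /=.
  rewrite (big_pred1 1%g) => [|s].
    by rewrite /koszul big_ord0 scale1r [permuted _ _]size0nil ?size_permuted.
  have enil : [seq val (s i) | i <- enum 'I_0] = [::].
    by apply: size0nil; rewrite size_map size_enum_ord.
  rewrite /shuffle enil /=.
  by apply/esym/eqP/permP => -[].
case: (tupleP w) => x {}w.
rewrite big_mkcond sum_lift_perm /=.
pose ins (k : nat) v := ksign (tag x * degs (take k v)) *: F (insert k x v).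
(* The value [0] of a shuffle can only sit at the start of a nonempty block: at [0], [a] or
   [a + b]. *)
transitivity (\sum_(p < n.+1) (
  (if (p == 0 :> nat) && (0 < a)%N then
     \sum_(s : 'S_n | shuffle [:: a.-1; b; c] s)
       koszul w s *: ins 0%N (permuted w s) else 0)
  + (if (p == a :> nat) && (0 < b)%N then
     \sum_(s : 'S_n | shuffle [:: a; b.-1; c] s)
       koszul w s *: ins a (permuted w s) else 0)
  + (if (p == a + b :> nat)%N && (0 < c)%N then
     \sum_(s : 'S_n | shuffle [:: a; b; c.-1] s)
       koszul w s *: ins (a + b)%N (permuted w s) else 0))).
  apply: eq_bigr => p _.
  rewrite -big_mkcond /=.
  under eq_bigl => s do rewrite shuffle_lift //.
  under eq_bigr => s _ do
    rewrite koszul_lift permuted_lift mulrC -scalerA -/(ins p _).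
  case: (boolP ((p == 0 :> nat) && _)) => [/andP[/eqP p0 a0]|p0].
    have -> : ((p == a :> nat) && (0 < b)%N) = false by lia.
    have -> : ((p == a + b :> nat)%N && (0 < c)%N) = false by lia.
    rewrite !addr0; apply: eq_big => [s|s _]; first by rewrite /= orbF.
    by rewrite p0.
  case: (boolP ((p == a :> nat) && _)) => [/andP[/eqP pa b0]|pa].
    have -> : ((p == a + b :> nat)%N && (0 < c)%N) = false by lia.
    rewrite add0r addr0; apply: eq_big => [s|s _]; first by rewrite /= orbF.
    by rewrite pa.
  case: (boolP ((p == a + b :> nat)%N && _)) => [/andP[/eqP pab c0]|pab].
    by rewrite !add0r; apply: eq_bigr => s _; rewrite pab.
  by rewrite !addr0 big_pred0.
have sumif k (C : bool) (v : U) : (C -> k < n.+1)%N ->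
    \sum_(p < n.+1) (if (p == k :> nat) && C then v else 0) =
    if C then v else 0.
  case: C => [/(_ isT) ltkn|_]; last by rewrite big1 // => i; rewrite andbF.
  rewrite (bigD1 (Ordinal ltkn)) //= eqxx big1 ?addr0 // => i.
  by rewrite -val_eqE /= => /negbTE ->.
rewrite !big_split /= !sumif; try lia.
have eqp k m : (0 < m)%N -> (k.+1 == m) = (k == m.-1) by lia.
rewrite !unshD; congr (_ + _ + _).
(* An empty block receives no letter, so both sides are then [0]; likewise for the other two
   blocks. *)
- case: ltnP => [a0|]; last first.
    rewrite leqn0 => /eqP->; rewrite -[LHS](unsh0 _ w).
    apply: eq_unsh => z r _ _; rewrite -[LHS](unsh0 _ z).
    by apply: eq_unsh => p q _ _.
  rewrite IHn; last by lia.
  apply: eq_unsh => z r _ _; apply: eq_unsh => p q _ _.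
  rewrite /shuffle_split /= eqp //; case: ifP => // _.
  by rewrite /ins take0 degs_nil mulr0 scale1r /insert take0 drop0.
- case: ltnP => [b0|]; last first.
    rewrite leqn0 => /eqP->; rewrite -[LHS](unsh0 _ w).
    apply: eq_unsh => z r _ _; rewrite -[LHS](unsh0 _ z).
    apply: eq_unsh => p q _ _; rewrite /shuffle_split andbF scaler0 //.
  rewrite IHn; last by lia.
  apply: eq_unsh => z r _ _; apply: eq_unsh => p q _ _.
  rewrite /shuffle_split /= eqp //.
  case: ifP => [/and3P[/eqP pa _ _]|]; last by rewrite scaler0.
  by rewrite /ins /insert take_size_cat // drop_size_cat.
- case: ltnP => [c0|]; last first.
  rewrite leqn0 => /eqP->; rewrite -[LHS](unsh0 _ w).
  apply: eq_unsh => z r _ _; rewrite -[LHS](scaler0 _ (ksign (tag x * degs z))).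
  rewrite -(unsh0 _ z); congr (_ *: _).
  by apply: eq_unsh => p q _ _; rewrite /shuffle_split !andbF.
rewrite IHn; last by lia.
apply: eq_unsh => z r _ _; rewrite -unshZ; apply: eq_unsh => p q szz dz.
rewrite /shuffle_split /= eqp //.
case: ifP => [/and3P[/eqP pa /eqP qb _]|]; last by rewrite scaler0.
rewrite /ins /insert !catA take_size_cat ?drop_size_cat ?size_cat ?pa ?qb //.
by rewrite degs_cat dz.
Qed.

Section ShuffleSums.
Variable U : lmodType K.

(** The counit law: only the splitting that sends every letter to the left survives. *)
Lemma unsh_nilr w (F : seq T -> U) :
  unsh w (fun p q => if nilp q then F p else 0) = F w.
Proof.
elim: w F => //= x w IHw F; rewrite IHw -[RHS]addr0; congr (_ + _).
by rewrite -[RHS](unsh0 U w); apply: eq_unsh => s t _ _; rewrite scaler0.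
Qed.

Lemma sum_shuffle3 n (w : n.-tuple T) a b c (G : seq T -> seq T -> seq T -> U) :
  (a + b + c = n)%N ->
  \sum_(s : 'S_n | shuffle [:: a; b; c] s) koszul w s *:
    G (take a (permuted w s)) (take b (drop a (permuted w s)))
      (drop (a + b) (permuted w s)) =
  unsh w (fun z r => unsh z (fun p q =>
    if (size p == a) && (size q == b) then G p q r else 0)).
Proof.
move=> szn.
rewrite (sum_shuffle w (fun v => G (take a v) (take b (drop a v))
                                   (drop (a + b) v)) szn).
apply: eq_unsh => z r szz _; apply: eq_unsh => p q szp _.
rewrite size_tuple in szz; rewrite /shuffle_split.
case: eqP => //= pa; case: eqP => //= qb.
rewrite ifT; last by apply/eqP; lia.
rewrite take_size_cat // [drop a _]drop_size_cat // take_size_cat //.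
by rewrite catA drop_size_cat // size_cat pa qb.
Qed.

Lemma sum_shuffle2 n (w : n.-tuple T) a (G : seq T -> seq T -> U) :
  (a <= n)%N ->
  \sum_(s : 'S_n | shuffle [:: a; n - a]%N s) koszul w s *:
    G (take a (permuted w s)) (drop a (permuted w s)) =
  unsh w (fun p q => if size p == a then G p q else 0).
Proof.
move=> lean.
(* Two blocks are three blocks with an empty last one; coassociativity and the counit law then
   remove it. *)
transitivity (\sum_(s : 'S_n | shuffle [:: a; n - a; 0]%N s) koszul w s *:
    G (take a (permuted w s)) (take (n - a) (drop a (permuted w s)))).
  apply: eq_big => [s|s _]; first by rewrite /shuffle /= take0.
  by rewrite [take (n - a) _]take_oversize // size_drop size_permuted.
rewrite (sum_shuffle3 w (fun p q _ => G p q)) ?addn0 ?subnKC //.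
transitivity (unsh w (fun z r => unsh z (fun p q =>
    if nilp r then if size p == a then G p q else 0 else 0))).
  apply: eq_unsh => z r szz _; apply: eq_unsh => p q szp _.
  rewrite size_tuple in szz; rewrite /nilp.
  case: eqP => pa; last by case: ifP.
  by rewrite /= (_ : (size q == n - a)%N = (size r == 0)%N) //; lia.
rewrite -(unsh_coassoc w (fun p q r =>
    if nilp r then if size p == a then G p q else 0 else 0)).
by apply: eq_unsh => p t _ _; rewrite unsh_nilr.
Qed.

Lemma sum_nat_pred1 m M k (v : U) :
  \sum_(m <= i < M) (if k == i then v else 0) =
  if (m <= k < M)%N then v else 0.
Proof.
rewrite -big_mkcond /=; case: ifP => [/andP[lemk ltkM]|out].
  rewrite big_nat_cond (big_rem k) /=; last by rewrite mem_index_iota lemk.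
  rewrite lemk ltkM eqxx /= big1_seq ?addr0 // => i /andP[/andP[_ /eqP <-]].
  by rewrite mem_rem_uniq ?iota_uniq // inE /= eqxx.
rewrite big_nat_cond big_pred0 // => i.
by apply/negP => /andP[im /eqP ki]; rewrite ki im in out.
Qed.

Lemma sum_shuffle2_range n (w : n.-tuple T) m M (G : seq T -> seq T -> U) :
  (M <= n.+1)%N ->
  \sum_(m <= i < M) \sum_(s : 'S_n | shuffle [:: i; n - i]%N s) koszul w s *:
    G (take i (permuted w s)) (drop i (permuted w s)) =
  unsh w (fun p q => if (m <= size p < M)%N then G p q else 0).
Proof.
move=> leMn; transitivity (\sum_(m <= i < M)
  unsh w (fun p q => if size p == i then G p q else 0)).
  apply: eq_big_nat => i /andP[_ ltiM]; rewrite sum_shuffle2 //.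
  by rewrite -ltnS (leq_trans ltiM).
rewrite -unsh_sum; apply: eq_unsh => p q _ _.
exact: sum_nat_pred1.
Qed.

(** The bounds on [i] and [j] single out the splittings with nonempty [q]: then [size q >= 1], and
    [size p < n] follows. *)
Lemma sum_shuffle3_all n (w : n.-tuple T) (G : seq T -> seq T -> seq T -> U) :
  \sum_(0 <= j < n) \sum_(1 <= i < n.+1 | (i + j <= n)%N)
    \sum_(s : 'S_n | shuffle [:: j; i; n - j - i]%N s) koszul w s *:
      G (take j (permuted w s)) (take i (drop j (permuted w s)))
        (drop (j + i) (permuted w s)) =
  unsh w (fun z r => unsh z (fun p q => if nilp q then 0 else G p q r)).
Proof.
transitivity (\sum_(0 <= j < n) \sum_(1 <= i < n.+1)
  unsh w (fun z r => unsh z (fun p q =>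
    if size p == j then if size q == i then G p q r else 0 else 0))).
  apply: eq_big_nat => j /andP[_ ltjn].
  rewrite big_mkcond; apply: eq_big_nat => i /andP[i0 ltin].
  case: leqP => [leijn|ltnij].
    rewrite sum_shuffle3; last by lia.
    apply: eq_unsh => z r _ _; apply: eq_unsh => p q _ _.
    by case: (size p == j).
  rewrite -[LHS](unsh0 U w); apply: eq_unsh => z r szz _.
  rewrite -[LHS](unsh0 U z); apply: eq_unsh => p q szp _.
  rewrite size_tuple in szz.
  by case: eqP => // pj; case: eqP => // qi; lia.
transitivity (\sum_(0 <= j < n)
  unsh w (fun z r => unsh z (fun p q =>
    if size p == j then if nilp q then 0 else G p q r else 0))).
  apply: eq_bigr => j _; rewrite -unsh_sum; apply: eq_unsh => z r szz _.
  rewrite -unsh_sum; apply: eq_unsh => p q szp _.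
  rewrite size_tuple in szz.
  case: ifP => _; last by rewrite big1.
  rewrite sum_nat_pred1 /nilp; case: (size q) szp => [|k] szp //=.
  by rewrite ifT //; lia.
rewrite -unsh_sum; apply: eq_unsh => z r szz _.
rewrite -unsh_sum; apply: eq_unsh => p q szp _.
rewrite size_tuple in szz; rewrite sum_nat_pred1 /nilp.
case: (size q) szp => [|k] szp; first by rewrite eqxx if_same.
by rewrite ifT //; lia.
Qed.

End ShuffleSums.

(** * Linearity and graded symmetry of coproduct sums; components *)

Lemma unsh_multilinear (U : lmodType K) (F : seq T -> seq T -> U) d a
    (u v : V d) s t :
  (forall p p' q, F (p ++ elt (a *: u + v) :: p') q =
     a *: F (p ++ elt u :: p') q + F (p ++ elt v :: p') q) ->
  (forall p q q', F p (q ++ elt (a *: u + v) :: q') =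
     a *: F p (q ++ elt u :: q') + F p (q ++ elt v :: q')) ->
  unsh (s ++ elt (a *: u + v) :: t) F =
  a *: unsh (s ++ elt u :: t) F + unsh (s ++ elt v :: t) F.
Proof.
elim: s F => [|x s IHs] F F1 F2 /=.
  rewrite scalerDr addrACA; congr (_ + _); rewrite -unshZ -unshD.
    by apply: eq_unsh => p q _ _; apply: (F1 [::]).
  apply: eq_unsh => p q _ _; rewrite (F2 _ [::]) /= scalerDr !scalerA.
  by rewrite [_ * a]mulrC.
rewrite !IHs.
- by rewrite scalerDr addrACA.
- move=> p p' q; rewrite !degs_cat !degs_cons /= F1 scalerDr !scalerA.
  by rewrite [_ * a]mulrC.
- move=> p q q'; rewrite -!cat_cons F2 scalerDr !scalerA.
  by rewrite [_ * a]mulrC.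
- by move=> p p' q; rewrite -!cat_cons F1.
- by move=> p q q'; rewrite F2.
Qed.

(** When both letters land on one side, a hypothesis applies. The two splittings that separate [y]
    from [z] are exchanged, and their signs differ by [ksign (tag y * tag z)]. *)
Lemma unsh_symmetric (U : lmodType K) (F : seq T -> seq T -> U) (y z : T) s t :
  (forall p p' q, F (p ++ y :: z :: p') q =
     ksign (tag y * tag z) *: F (p ++ z :: y :: p') q) ->
  (forall p q q', F p (q ++ y :: z :: q') =
     ksign (tag y * tag z) *: F p (q ++ z :: y :: q')) ->
  unsh (s ++ y :: z :: t) F =
  ksign (tag y * tag z) *: unsh (s ++ z :: y :: t) F.
Proof.
elim: s F => [|x s IHs] F F1 F2 /=.
  rewrite !scalerDr [RHS]addrACA -!unshZ.
  congr (_ + _ + (_ + _)); apply: eq_unsh => p q _ _.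
  - exact: (F1 [::]).
  - rewrite scalerA degs_cons mulrDr ksignD mulrA [tag z * tag y]mulrC.
    by rewrite ksign_sq mul1r.
  - by rewrite scalerA degs_cons mulrDr ksignD.
  - rewrite (F2 _ [::]) /= !scalerA; congr (_ *: _).
    by rewrite [RHS]mulrC; congr (_ * _); rewrite mulrC.
rewrite !IHs ?scalerDr //.
- move=> p p' q; rewrite F1 !scalerA mulrC; congr (_ * ksign (_ * _) *: _).
  by rewrite !degs_cat !degs_cons; congr (_ + _); rewrite addrCA.
- by move=> p q q'; rewrite -!cat_cons F2 !scalerA mulrC.
- by move=> p p' q; rewrite -!cat_cons F1.
Qed.

Lemma component_elt d (v : V d) : component d (elt v) = v.
(* The transport is along a proof of [d = d], which is trivial because equality on integers is
   decidable. *)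
Proof. by rewrite /component /untag; case: eqP => //= p; rewrite eq_axiomK. Qed.

Lemma component_neq e (h : T) : tag h != e -> component e h = 0.
Proof. exact: untag_dflt. Qed.

Lemma component0 e d : component e (elt (0 : V d)) = 0.
Proof.
have [<-|ned] := eqVneq d e; first exact: component_elt.
exact: component_neq.
Qed.

Lemma componentK d (h : T) : tag h = d -> elt (component d h) = h.
Proof. by case: h => d' v /= <-; rewrite component_elt. Qed.

Lemma multilinear0 (W : gradedSpace K) (f : seq T -> homog W) s t d e :
  multilinear f -> component e (f (s ++ elt (0 : V d) :: t)) = 0.
Proof.
move=> /(_ s t d (-1) 0 0 e).
by rewrite scaler0 addr0 scaleN1r addNr.
Qed.

(** Sums of letters exist only within one degree [d]; the hypothesis on [tag] ensures that
    [component d] loses nothing. *)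
Lemma multilinear_unsh (W : gradedSpace K) (f : seq T -> homog W) s t d e w
    (F : seq T -> seq T -> T) :
  multilinear f ->
  (forall p q, degs p + degs q = degs w -> tag (F p q) = d) ->
  component e (f (s ++ elt (unsh w (fun p q => component d (F p q))) :: t)) =
  unsh w (fun p q => component e (f (s ++ F p q :: t))).
Proof.
move=> mf tagF.
rewrite (unsh_linear (f := fun v : V d => component e (f (s ++ elt v :: t)))).
  by apply: eq_unsh => p q _ dpq; rewrite componentK // tagF.
by move=> a u v; apply: mf.
Qed.

(** * The sub-adjacent brackets of a post-Lie$_\infty$ algebra *)

Section PostLie.
Variables (M : ops2 V V) (HM : is_postLie_infty M).
Local Notation R := (extend0 M).
Local Notation lC := (app (sub_adjacent M)).

Lemma extend0_nil s :
  app2 R s [::] = elt (0 : V (degs s + degs ([::] : seq T) + 1)).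
Proof. by []. Qed.

Lemma extend0_catr s t x t' : app2 R s (t ++ x :: t') = app2 M s (t ++ x :: t').
Proof. by case: t. Qed.

Lemma extend0_linear_l t : linear_on_S (fun s => app2 R s t).
Proof.
have [HM1 _ _] := HM; case: t => [|x t]; last exact: HM1.
split=> [s t d a u v e|s t v w e]; rewrite !extend0_nil !component0.
  by rewrite scaler0 addr0.
by rewrite scaler0.
Qed.

Lemma extend0_linear_r s : linear_on_S (app2 R s).
Proof.
have [_ HM2 _] := HM; have [HM2m HM2s] := HM2 s.
split=> [t t' d a u v e|t t' v w e]; rewrite !extend0_catr.
  exact: HM2m.
exact: HM2s.
Qed.

Lemma tag_app2 s t : tag (app2 R s t) = degs s + degs t + 1.
Proof. by []. Qed.

(** The range [j < size w] omits only the splitting with empty second word, where [extend0]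
    vanishes, so the coproduct may be taken unrestricted. *)
Lemma sub_adjacentE w :
  sub_adjacent M w =
  unsh w (fun p q => component (degs w + 1) (app2 R p q)).
Proof.
rewrite /sub_adjacent.
rewrite (sum_shuffle2_range (in_tuple w) _
  (fun p q => component (degs w + 1) (app2 M p q))) //.
apply: eq_unsh => p q szw _ /=.
case: q szw => [|y q] /= szw; last by rewrite ifT // -szw addnS ltnS leq_addr.
by rewrite -szw addn0 ltnn component0.
Qed.

(** Every term has degree [degs w + 1], so in any other degree both sides vanish. *)
Lemma component_sub_adjacent e w :
  component e (lC w) = unsh w (fun p q => component e (app2 R p q)).
Proof.
rewrite /app sub_adjacentE.
have [<-|ned] := eqVneq (degs w + 1) e; first by rewrite component_elt.
rewrite component_neq // -[LHS](unsh0 _ w).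
apply: eq_unsh => p q _ dpq; rewrite component_neq //.
by rewrite tag_app2 dpq.
Qed.

Lemma sub_adjacent_linear : linear_on_S lC.
Proof.
split=> [s t d a u v e|s t y z e]; rewrite !component_sub_adjacent.
  apply: unsh_multilinear => [p p' q|p q q'].
    by have [mR _] := extend0_linear_l q; apply: mR.
  by have [mR _] := extend0_linear_r p; apply: mR.
apply: unsh_symmetric => [p p' q|p q q'].
  by have [_ sR] := extend0_linear_l q; apply: sR.
by have [_ sR] := extend0_linear_r p; apply: sR.
Qed.

(* Extending by M_{p,0} = 0 lets all the block sizes range freely, and the
   identity then also holds, trivially, for the empty word y. *)
Lemma postLie_unsh z y e :
  unsh z (fun s p => unsh s (fun a b =>
    component e (app2 R (app2 R a b :: p) y))) +
  unsh z (fun p a => unsh y (fun b q =>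
    ksign (degs p) *: component e (app2 R p (app2 R a b :: q)))) = 0.
Proof.
case: y => [|y0 y].
  rewrite -[RHS]addr0; congr (_ + _).
    rewrite -[RHS](unsh0 _ z); apply: eq_unsh => s p _ _.
    rewrite -[RHS](unsh0 _ s); apply: eq_unsh => a b _ _.
    exact: component0.
  rewrite -[RHS](unsh0 _ z); apply: eq_unsh => p a _ _ /=.
  have [mR _] := extend0_linear_r p.
  by rewrite extend0_nil (multilinear0 [::]) ?scaler0.
have [_ _ /(_ _ _ (in_tuple z) (in_tuple (y0 :: y)) e isT)] := HM.
set A := (X in X + _) => E; rewrite -[RHS]E {E}.
congr (_ + _).
  rewrite {}/A (sum_shuffle3_all (in_tuple z)
    (fun a b p => component e (app2 M (app2 M a b :: p) (y0 :: y)))).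
  apply: eq_unsh => s p _ _; apply: eq_unsh => a b _ _.
  (* For empty [b] the inner value is [0], and multilinearity kills the outer one. *)
  case: b => //=; rewrite extend0_nil.
  have [mR _] := extend0_linear_l (y0 :: y).
  exact: (multilinear0 [::] _ _ _ mR).
set n := size z.
(* [G p a] is the second sum for a fixed splitting of [z]; this lets the shuffles of [y] be summed
   before those of [z]. *)
pose G p a := unsh (y0 :: y) (fun b q =>
    ksign (degs p) *: component e (app2 R p (app2 R a b :: q))).
have EG (c : K) p a :
  \sum_(1 <= i < (size (y0 :: y)).+1)
    \sum_(t : 'S_(size (y0 :: y)) | shuffle [:: i; size (y0 :: y) - i]%N t)
      (c * koszul (in_tuple (y0 :: y)) t * (-1) ^ degs p) *: component e
        (app2 M p (app2 M a (take i (permuted (in_tuple (y0 :: y)) t))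
                   :: drop i (permuted (in_tuple (y0 :: y)) t))) =
    c *: G p a.
  transitivity (c *: \sum_(1 <= i < (size (y0 :: y)).+1)
    \sum_(t : 'S_(size (y0 :: y)) | shuffle [:: i; size (y0 :: y) - i]%N t)
      koszul (in_tuple (y0 :: y)) t *: (ksign (degs p) *: component e
        (app2 M p (app2 M a (take i (permuted (in_tuple (y0 :: y)) t))
                   :: drop i (permuted (in_tuple (y0 :: y)) t))))).
    rewrite scaler_sumr; apply: eq_bigr => i _.
    rewrite scaler_sumr; apply: eq_bigr => t _.
    by rewrite !scalerA.
  rewrite (sum_shuffle2_range (in_tuple (y0 :: y)) _
    (fun b q => ksign (degs p) *: component e (app2 M p (app2 M a b :: q)))) //.
  congr (_ *: _); apply: eq_unsh => b q szb _.
  case: b szb => [|b0 b] szb; last by rewrite ifT // -szb ltnS leq_addr.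
  have [mR _] := extend0_linear_r p.
  by rewrite extend0_nil (multilinear0 [::]) ?scaler0.
under [RHS]eq_bigr => j _ do under eq_bigr => s _ do rewrite EG.
(* Reversing the summation turns [(n - j, j)]-shuffles into [(j, n - j)]-shuffles. *)
rewrite big_nat_rev /= add0n.
transitivity (\sum_(0 <= j < n.+1) \sum_(s : 'S_n | shuffle [:: j; n - j]%N s)
  koszul (in_tuple z) s *: G (take j (permuted (in_tuple z) s))
                             (drop j (permuted (in_tuple z) s))).
  rewrite sum_shuffle2_range //; apply: eq_unsh => p a szz _.
  by rewrite ifT // ltnS (leq_trans _ (eq_leq szz)) ?leq_addr.
apply: eq_big_nat => j /andP[_]; rewrite ltnS => lejn.
by rewrite subSS subKn.
Qed.

Lemma sub_adjacent_Linfty_unsh w e :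
  unsh w (fun s t => component e (lC (lC s :: t))) = 0.
Proof.
(* The letter [lC s] heads the outer word, so [unsh] branches on it first. Going right it passes
   [p], and its degree [degs s + 1] gives the sign. *)
transitivity (
  unsh w (fun s t => unsh t (fun p q => unsh s (fun a b =>
    component e (app2 R (app2 R a b :: p) q)))) +
  unsh w (fun s t => unsh t (fun p q => ksign ((degs s + 1) * degs p) *:
    unsh s (fun a b => component e (app2 R p (app2 R a b :: q)))))).
  rewrite -unshD; apply: eq_unsh => s t _ _.
  rewrite component_sub_adjacent /=; congr (_ + _).
    apply: eq_unsh => p q _ _; have [mR _] := extend0_linear_l q.
    rewrite {1}/app sub_adjacentE.
    by apply: (multilinear_unsh [::] _ _ mR) => a b <-.
  apply: eq_unsh => p q _ _; have [mR _] := extend0_linear_r p.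
  congr (_ *: _); rewrite {1}/app sub_adjacentE.
  by apply: (multilinear_unsh [::] _ _ mR) => a b <-.
rewrite unsh_coassoc [X in _ + X]unsh_coassoc.
transitivity (unsh w (fun z y =>
  unsh z (fun s p => unsh s (fun a b =>
    component e (app2 R (app2 R a b :: p) y))) +
  unsh z (fun p a => unsh y (fun b q =>
    ksign (degs p) *: component e (app2 R p (app2 R a b :: q)))))).
  rewrite unshD; congr (_ + _).
  transitivity (unsh w (fun z q => unsh z (fun p s => unsh s (fun a b =>
    ksign (degs p) *: component e (app2 R p (app2 R a b :: q)))))).
    (* Exchanging [s] and [p] cancels $(-1)^{sp}$ and leaves the sign $(-1)^p$ of the post-Lie
       identity. *)
    apply: eq_unsh => z q _ _; rewrite unsh_cocomm.
    apply: eq_unsh => p s _ _; rewrite scalerA -unshZ.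
    apply: eq_unsh => a b _ _; congr (_ *: _).
    by rewrite mulrDl mul1r ksignD mulrA [degs p * _]mulrC ksign_sq mul1r.
  (* Both sides run over the fourfold coproduct [w -> (p, a, b, q)]; once [p] is split off first,
     only the bracketing of [(a, b, q)] differs. *)
  rewrite -(unsh_coassoc w (fun p s q => unsh s (fun a b =>
    ksign (degs p) *: component e (app2 R p (app2 R a b :: q))))).
  rewrite -(unsh_coassoc w (fun p a y => unsh y (fun b q =>
    ksign (degs p) *: component e (app2 R p (app2 R a b :: q))))).
  apply: eq_unsh => p r _ _; rewrite -(unsh_coassoc r (fun a b q =>
    ksign (degs p) *: component e (app2 R p (app2 R a b :: q)))) //.
rewrite -[RHS](unsh0 _ w); apply: eq_unsh => z y _ _.
exact: postLie_unsh.
Qed.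

Lemma sub_adjacent_Linfty : is_Linfty (sub_adjacent M).
Proof.
split=> [|n x e _]; first exact: sub_adjacent_linear.
rewrite (sum_shuffle2_range x _ (fun s t => component e (lC (lC s :: t)))) //.
rewrite -[RHS](sub_adjacent_Linfty_unsh x e); apply: eq_unsh => s t szx _.
rewrite size_tuple in szx.
(* The Jacobi sum starts at [i = 1]; the extra term with empty [s] vanishes because [lC [::]] is
   [0]. *)
case: s szx => [|s0 s] /= szx; last by rewrite ifT // -szx ltnS leq_addr.
rewrite {2}/app sub_adjacentE /= component0.
by have [mC _] := sub_adjacent_linear; rewrite (multilinear0 [::] _ _ _ mC).
Qed.

(** This is [postLie_unsh] with the sum over [(a, b)] in its first part collected into [lC s]. *)
Lemma sub_adjacent_open_closed : is_open_closed (sub_adjacent M) R.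
Proof.
split=> [||//|n m x u e _]; first exact: sub_adjacent_Linfty.
  by split; [apply: extend0_linear_l | apply: extend0_linear_r].
rewrite -[RHS](postLie_unsh x u e); congr (_ + _).
  rewrite (sum_shuffle2_range x _
    (fun s t => component e (app2 R (lC s :: t) u))) //.
  apply: eq_unsh => s t szx _; have [mR _] := extend0_linear_l u.
  rewrite size_tuple in szx.
  transitivity (component e (app2 R (lC s :: t) u)); last first.
    rewrite {1}/app sub_adjacentE.
    by apply: (multilinear_unsh [::] _ _ mR) => a b <-.
  case: s szx => [|s0 s] /= szx; last by rewrite ifT // -szx ltnS leq_addr.
  by rewrite /app sub_adjacentE /= component0 (multilinear0 [::] _ _ _ mR).
pose G p a := unsh u (fun b q =>
    ksign (degs p) *: component e (app2 R p (app2 R a b :: q))).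
transitivity (\sum_(0 <= i < n.+1) \sum_(s : 'S_n | shuffle [:: i; n - i]%N s)
  koszul x s *: G (take i (permuted x s)) (drop i (permuted x s))).
  (* The sum over [s] moves outside the one over [k], so that for each splitting of [x] the shuffles
     of [u] are summed first. *)
  apply: eq_bigr => i _; rewrite exchange_big; apply: eq_bigr => s _ /=.
  transitivity (koszul x s *: \sum_(0 <= k < m.+1)
    \sum_(t : 'S_m | shuffle [:: k; m - k]%N t)
      koszul u t *: (ksign (degs (take i (permuted x s))) *: component e
        (app2 R (take i (permuted x s))
          (app2 R (drop i (permuted x s)) (take k (permuted u t))
                   :: drop k (permuted u t))))).
    rewrite scaler_sumr; apply: eq_bigr => k _.
    rewrite scaler_sumr; apply: eq_bigr => t _.
    by rewrite !scalerA.
  congr (_ *: _); set p := take i _; set a := drop i _.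
  rewrite (sum_shuffle2_range u _ (fun b q =>
    ksign (degs p) *: component e (app2 R p (app2 R a b :: q)))) //.
  apply: eq_unsh => b q; rewrite size_tuple => szb _.
  by rewrite ifT // ltnS -szb leq_addr.
rewrite sum_shuffle2_range //; apply: eq_unsh => p a; rewrite size_tuple => szx _.
by rewrite ifT // ltnS -szx leq_addr.
Qed.

End PostLie.
End Unshuffle.

Theorem theorem4p12 (K : fieldType) (charK : [pchar K] =i pred0)
  (g : gradedSpace K) (M : ops2 g g) (HM : is_postLie_infty M) :
  is_Linfty (sub_adjacent M) /\
  (is_open_closed (sub_adjacent M) (extend0 M) /\
   (forall s : seq (homog g), (1 <= size s)%N -> extend0 M s [::] = 0)).
Proof.
split; first exact: sub_adjacent_Linfty.
by split; first exact: sub_adjacent_open_closed.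
Qed.
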